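(* Let $S,T$ be two lattices that have a maximum element, let $X$ be a nonempty set, let $Y$ be a nonempty $T_1$ topological space, let $\mathcal{F}=\mathrm{lsc}(Y,S)\subset S^Y$ and let $\mathcal{G}\subset T^X$, where $\mathcal{F}$ and $\mathcal{G}$ are lattices of functions containing all the Dirac functions of $S^Y$ and $T^X$ respectively. Let $(B,B^\circ)$ be a dual Galois connection between $\mathcal{F}$ and $\mathcal{G}$, and let $b:X\times Y\times S\to T$ and $b^\circ:Y\times X\times T\to S$ be its kernels. Then, for all $(x,s)\in X\times S$, the map $b(x,\cdot,s):Y\to T$ is l.s.c.
   Context: A pair of maps $B:\mathcal{F}\to\mathcal{G}$, $C:\mathcal{G}\to\mathcal{F}$ between partially ordered sets is a dual Galois connection if for all $f\in\mathcal{F}$, $g\in\mathcal{G}$: $g\geq Bf\iff f\geq Cg$; $C$ is determined by $B$ and denoted $B^\circ$. For a lattice $S$, $S^Y$ has the pointwise order; a lattice of functions is a sublattice of $S^Y$. The Dirac function $\delta_y^s\in S^Y$ takes the value $s$ at $y$ and the maximum element $\top_S$ elsewhere; likewise for $\delta_x^t\in T^X$. A map $f:Y\to S$ from a topological space to a lattice is l.s.c. (lower semicontinuous) if for all $s\in S$ the sublevel set $\{y\in Y\mid f(y)\leq s\}$ is closed; $\mathrm{lsc}(Y,S)$ is the set of l.s.c. maps from $Y$ to $S$. The same definition applies to maps into $T$. The kernels of $(B,B^\circ)$ are the (unique) maps $b,b^\circ$ such that: for all $(x,y)$, $(b(x,y,\cdot),b^\circ(y,x,\cdot))$ is a dual Galois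 connection between $S$ and $T$; $b^\circ(\cdot,x,t)\in\mathcal{F}$ for all $(x,t)\in X\times T$; $b(\cdot,y,s)\in\mathcal{G}$ for all $(y,s)\in Y\times S$; and $Bf=\sup_{\mathcal{G}}\{b(\cdot,y,f(y))\mid y\in Y\}$, $B^\circ g=\sup_{\mathcal{F}}\{b^\circ(\cdot,x,g(x))\mid x\in X\}$ for all $f\in\mathcal{F}$, $g\in\mathcal{G}$ (least upper bounds in $\mathcal{G}$ and $\mathcal{F}$). They are given by $b(\cdot,y,s)=B\delta_y^s$ and $b^\circ(\cdot,x,t)=B^\circ\delta_x^t$. *)

(* Defs.v *)
From HB Require Import structures.
From mathcomp Require Import all_boot all_order all_classical.
From mathcomp Require Import topology.

Set Implicit Arguments.
Unset Strict Implicit.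
Unset Printing Implicit Defensive.

Import Order.Theory.
Local Open Scope classical_set_scope.
Local Open Scope order_scope.

(* The library orders [X -> T] pointwise; a subset of an ordered type, seen as
   a type (such as a set of functions), receives the induced order. *)
HB.instance Definition _ d (T : porderType d) (P : pred T) :=
  [SubChoice_isSubPOrder of {x : T | P x} by <: with d].

Definition dual_galois d1 d2 (P : porderType d1) (Q : porderType d2)
    (B : P -> Q) (C : Q -> P) : Prop :=
  forall f g, g >= B f <-> f >= C g.

Definition is_sublattice d (L : latticeType d) (A : set L) : Prop :=
  forall f g, A f -> A g -> A (f `&` g)%O /\ A (f `|` g)%O.

Definition dirac_fun (Z : Type) d (L : tLatticeType d) (z : Z) (l : L) :
    Z -> L :=
  fun w => if `[< w = z >] then l else \top.

Definition lsc (Y : topologicalType) d (L : latticeType d) : set (Y -> L) :=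
  [set f | forall l : L, closed [set y | f y <= l]].

Arguments lsc : clear implicits.
Arguments lsc Y {d} L.

(* [b x y s] and [bo y x t] stand for b(x,y,s) and b°(y,x,t). The least upper
   bounds are taken inside G and F, not in the ambient function spaces. *)
Record is_kernels (X Y : Type) d1 d2 (S : latticeType d1) (T : latticeType d2)
    (F : set (Y -> S)) (G : set (X -> T)) (B : F -> G) (Bo : G -> F)
    (b : X -> Y -> S -> T) (bo : Y -> X -> T -> S) : Prop := IsKernels {
  kernels_galois : forall x y, dual_galois (b x y) (bo y x) ;
  kernels_bo_mem : forall x t, F (fun y => bo y x t) ;
  kernels_b_mem : forall y s, G (fun x => b x y s) ;
  kernels_b_sup : forall f : F,
    isLub [set h : G | exists y, \val h = fun x => b x y (\val f y)] (B f) ;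
  kernels_bo_sup : forall g : G,
    isLub [set h : F | exists x, \val h = fun y => bo y x (\val g x)] (Bo g)
}.

(* Main.v *)
Require Import Defs.
From HB Require Import structures.
From mathcomp Require Import all_boot all_order all_classical.
From mathcomp Require Import topology.

(** The Galois connection between [b x y] and [bo y x] exchanges sublevel sets: the one of [b x _ s]
    at level [t] is the one of [bo _ x t] at level [s]. The latter is closed because [bo _ x t] lies
    in [lsc Y S] by [kernels_bo_mem]. *)

Theorem proposition2p3
  (d1 d2 : Order.disp_t) (S : tLatticeType d1) (T : tLatticeType d2)
  (X : Type) (X_nonempty : inhabited X)
  (Y : topologicalType) (Y_nonempty : inhabited Y) (Y_T1 : accessible_space Y)
  (G : set (X -> T))
  (F_lattice : is_sublattice (lsc Y S)) (G_lattice : is_sublattice G)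
  (F_dirac : forall (y : Y) (s : S), lsc Y S (dirac_fun y s))
  (G_dirac : forall (x : X) (t : T), G (dirac_fun x t))
  (B : lsc Y S -> G) (Bo : G -> lsc Y S) (BBo_galois : dual_galois B Bo)
  (b : X -> Y -> S -> T) (bo : Y -> X -> T -> S)
  (b_kernels : is_kernels B Bo b bo) :
  forall (x : X) (s : S), lsc Y T (fun y => b x y s).
Proof.
move=> x s t.
suff -> : [set y | b x y s <= t]%classic%O = [set y | bo y x t <= s]%classic%O.
  have lsc_bo := kernels_bo_mem b_kernels x t.
  exact: lsc_bo.
(* With [x], [s], [t] fixed, the Galois equivalence holds at each [y], so it gives both
   inclusions. *)
by apply/seteqP; split=> y /(kernels_galois b_kernels x y s t).
Qed.
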